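(* Let $\Lambda$ and $\Gamma$ be two algebras, each of the form $kQ/I$ with $k$ a field, $Q$ a finite quiver and $I$ an admissible ideal. Let $P_\Lambda, Q_\Lambda$ be basic projective $\Lambda$-modules and $P_\Gamma, Q_\Gamma$ projective $\Gamma$-modules (none of them necessarily indecomposable). Assume there is an additive functor $F: \mathrm{add}(P_\Lambda\oplus Q_\Lambda)\to \mathrm{add}(P_\Gamma\oplus Q_\Gamma)$ such that: (F1) $F(P_\Lambda)=P_\Gamma$; (F2) $F(Q_\Lambda)=Q_\Gamma$; (F3) the map $\mathrm{Hom}_\Lambda(P_\Lambda,Q_\Lambda)\to \mathrm{Hom}_\Gamma(P_\Gamma,Q_\Gamma)$ induced by $F$ is surjective; (F4) for every $P$ in $\mathrm{add}(P_\Lambda\oplus Q_\Lambda)$, the vector $g^{F(P)}$ equals $g^P$ in all coordinates where both are defined, and is $0$ in all other coordinates. Let $\mathbb{P} = (P'\xrightarrow{\phi} Q')$ be a 2-term pre-silting complex over $\Lambda$ with $P'\in\mathrm{add}\,P_\Lambda$ (in degree $-1$) and $Q'\in\mathrm{add}\,Q_\Lambda$ (in degree $0$). Then $$F(\mathbb{P}) = \big(F(P')\xrightarrow{F(\phi)} F(Q')\big)$$ is a 2-term pre-silting complex over $\Gamma$.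
   Context: Modules are finite-dimensional left modules. $\mathrm{add}\,M$ is the category of modules all of whose indecomposable summands are summands of $M$. A module is basic if no two of its nonzero indecomposable summands in a decomposition are isomorphic. Complexes use cohomological notation; for an algebra $A$, a complex $\mathbb{P}$ in the bounded homotopy category $K^b(\mathrm{add}\,A)$ of finitely generated projective $A$-modules is 2-term if $\mathbb{P}^i=0$ for all $i\notin\{0,-1\}$. A 2-term complex $\mathbb{P}$ is pre-silting if it is rigid, i.e. $\mathrm{Hom}_{K^b(\mathrm{add}\,A)}(\mathbb{P},\mathbb{P}[1])=0$. The indecomposable projective modules of each algebra are ordered as $P(1),\dots,P(n)$ ($n$ the number of simple modules, which may differ for $\Lambda$ and $\Gamma$); for a projective module $P\cong\bigoplus_{i=1}^n P(i)^{u_i}$ the $g$-vector is $g^P=(u_1,\dots,u_n)$. *)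

(* Defs.v *)
From HB Require Import structures.
From mathcomp Require Import all_boot all_order all_algebra.
From mathcomp Require Import generic_quotient ring_quotient finmap.
From mathcomp Require Import monalg.

Set Implicit Arguments.
Unset Strict Implicit.
Unset Printing Implicit Defensive.

Import GRing.Theory.
Local Open Scope ring_scope.
Local Open Scope quotient_scope.

(* A k-algebra, as a ring A with a ring morphism from k to the center of A.
   MathComp's algType requires 1 != 0 and so excludes the zero algebra, which is
   kQ/I for the empty quiver Q. *)
HB.mixin Record PzRing_isAlgOver (k : pzRingType) A of GRing.PzRing A := {
  alg_scalar : {rmorphism k -> A};
  alg_scalar_central : forall (c : k) (x : A), alg_scalar c * x = x * alg_scalar c
}.

#[short(type="pzAlgType")]
HB.structure Definition PzAlgebra (k : pzRingType) :=
  {A of PzRing_isAlgOver k A & GRing.PzRing A}.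

Arguments alg_scalar {k} s.

Record quiver := Quiver {
  vertex : finType;
  arrow : finType;
  src : arrow -> vertex;
  tgt : arrow -> vertex
}.

Section Paths.
Variable Q : quiver.

Fixpoint is_path (v : vertex Q) (s : seq (arrow Q)) : bool :=
  if s is a :: s' then (src a == v) && is_path (tgt a) s' else true.

Fixpoint path_end (v : vertex Q) (s : seq (arrow Q)) : vertex Q :=
  if s is a :: s' then path_end (tgt a) s' else v.

(* A path is its starting vertex together with its list of arrows, in the order
   in which they are traversed; (v, [::]) is the lazy path at v. *)
Definition qpath := {x : vertex Q * seq (arrow Q) | is_path x.1 x.2}.

Definition lazy_path (v : vertex Q) : qpath := exist _ (v, [::]) isT.

Lemma is_path_arrow (a : arrow Q) : is_path (src a) [:: a].
Proof. by rewrite /= eqxx. Qed.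

Definition arrow_path (a : arrow Q) : qpath :=
  exist _ (src a, [:: a]) (is_path_arrow a).

(* "p, then q" when q starts where p ends (insub is then never None), and None
   when p and q do not compose. *)
Definition pconcat (p q : qpath) : option qpath :=
  if path_end (val p).1 (val p).2 == (val q).1
  then (insub ((val p).1, (val p).2 ++ (val q).2) : option qpath) else None.

Lemma is_path_cat v s t :
  is_path v (s ++ t) = is_path v s && is_path (path_end v s) t.
Proof. by elim: s v => //= a s IH v; rewrite IH andbA. Qed.

Lemma path_end_cat v s t :
  path_end v (s ++ t) = path_end (path_end v s) t.
Proof. by elim: s v => /=. Qed.

Lemma pconcatA p q r :
  obind (pconcat^~ r) (pconcat p q) = obind (pconcat p) (pconcat q r).
Proof.
case: p q r => [[v s] /= hs] [[w t] /= ht] [[x u] /= hu]; rewrite /pconcat /=.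
have [ew|nw] := eqVneq (path_end v s) w; last first.
  by case: eqP => //= _; case: insubP => //= y _ ->; rewrite (negbTE nw).
have hst : is_path v (s ++ t) by rewrite is_path_cat hs ew ht.
rewrite insubT /= path_end_cat ew; case: eqP => [ex|]; last by [].
have htu : is_path w (t ++ u) by rewrite is_path_cat ht ex hu.
by rewrite [insub (w, _)]insubT /= eqxx catA.
Qed.

Lemma pconcat1 v q : pconcat (lazy_path v) q = if v == (val q).1 then Some q else None.
Proof.
case: q => [[w t] /= ht]; rewrite /pconcat /=; case: eqP => // ->.
by rewrite insubT /=; congr Some; apply: val_inj.
Qed.

Lemma pconcat_1 v p : pconcat p (lazy_path v) =
  if path_end (val p).1 (val p).2 == v then Some p else None.
Proof.
case: p => [[w t] /= ht]; rewrite /pconcat /=; case: eqP => // _.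
by rewrite cats0 insubT /=; congr Some; apply: val_inj.
Qed.

End Paths.

Lemma bilinear_assoc (k : pzRingType) (V : lmodType k) (T : Type)
    (u : T -> V) (m : V -> V -> V) :
  (forall P : V -> Prop, P 0 -> (forall f g, P f -> P g -> P (f + g)) ->
     (forall c f, P f -> P (c *: f)) -> (forall p, P (u p)) ->
     forall f, P f) ->
  left_distributive m +%R -> right_distributive m +%R ->
  (forall c f g, c *: m f g = m (c *: f) g) ->
  (forall c f g, c *: m f g = m f (c *: g)) ->
  (forall p q r, m (u p) (m (u q) (u r)) =
                 m (m (u p) (u q)) (u r)) ->
  associative m.
Proof.
move=> vind mDl mDr mZl mZr mU.
have m0l g : m 0 g = 0 by rewrite -{1}(scale0r (0 : V)) -mZl scale0r.
have m0r f : m f 0 = 0 by rewrite -{1}(scale0r (0 : V)) -mZr scale0r.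
move=> f g h; elim/vind: f => [|f f' IH IH'|c f IH|p].
- by rewrite !m0l.
- by rewrite !mDl IH IH'.
- by rewrite -!mZl IH.
elim/vind: g => [|f f' IH IH'|c f IH|q].
- by rewrite m0l !m0r m0l.
- by rewrite mDl !mDr mDl IH IH'.
- by rewrite -mZl -!mZr -mZl IH.
elim/vind: h => [|f f' IH IH'|c f IH|r].
- by rewrite !m0r.
- by rewrite !mDr IH IH'.
- by rewrite -!mZr IH.
exact: mU.
Qed.

(* The path algebra kQ: finitely supported functions on the set of paths. *)
Definition path_alg (k : fieldType) (Q : quiver) : Type := {malg k[qpath Q]}.

Section PathAlgebra.
Variables (k : fieldType) (Q : quiver).

HB.instance Definition _ := GRing.Lmodule.on (path_alg k Q).
Local Notation kQ := (path_alg k Q).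
Implicit Types (f g h : kQ) (p q r : qpath Q).

Definition path_elt (p : qpath Q) : kQ := << p >>.

Definition path_mul p q : kQ := oapp path_elt 0 (pconcat p q).

Definition pa_mul f g : kQ :=
  \sum_(p <- msupp f) \sum_(q <- msupp g) (f@_p * g@_q) *: path_mul p q.

Definition pa_one : kQ := \sum_(v : vertex Q) path_elt (lazy_path v).

Lemma pa_mulw (d1 d2 : {fset qpath Q}) f g :
  (msupp f `<=` d1)%fset -> (msupp g `<=` d2)%fset ->
  pa_mul f g = \sum_(p <- d1) \sum_(q <- d2) (f@_p * g@_q) *: path_mul p q.
Proof.
move=> le1 le2; rewrite /pa_mul (big_fset_incl _ le1) /=.
  apply/eq_bigr=> p _; apply/big_fset_incl => // q _ /mcoeff_outdom ->.
  by rewrite mulr0 scale0r.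
by move=> p _ /mcoeff_outdom fp; rewrite big1 // => q _; rewrite fp mul0r scale0r.
Qed.

Lemma pa_mulDl : left_distributive pa_mul +%R.
Proof.
move=> f g h; pose d := (msupp f `|` msupp g)%fset.
rewrite (@pa_mulw d (msupp h) (f + g)) ?msuppD_le // (@pa_mulw d (msupp h) f) ?fsubsetUl //.
rewrite (@pa_mulw d (msupp h) g) ?fsubsetUr // -big_split; apply: eq_bigr => p _.
rewrite -big_split; apply: eq_bigr => q _.
by rewrite /= mcoeffD mulrDl scalerDl.
Qed.

Lemma pa_mulDr : right_distributive pa_mul +%R.
Proof.
move=> h f g; pose d := (msupp f `|` msupp g)%fset.
rewrite (@pa_mulw (msupp h) d h (f + g)) ?msuppD_le // (@pa_mulw (msupp h) d h f) ?fsubsetUl //.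
rewrite (@pa_mulw (msupp h) d h g) ?fsubsetUr // -big_split; apply: eq_bigr => p _.
rewrite -big_split; apply: eq_bigr => q _.
by rewrite /= mcoeffD mulrDr scalerDl.
Qed.

Lemma pa_mulZl c f g : c *: pa_mul f g = pa_mul (c *: f) g.
Proof.
rewrite (@pa_mulw (msupp f) (msupp g) (c *: f)) ?msuppZ_le // scaler_sumr.
apply: eq_bigr => p _; rewrite scaler_sumr; apply: eq_bigr => q _.
by rewrite scalerA mcoeffZ mulrA.
Qed.

Lemma pa_mulZr c f g : c *: pa_mul f g = pa_mul f (c *: g).
Proof.
rewrite (@pa_mulw (msupp f) (msupp g) f (c *: g)) ?msuppZ_le // scaler_sumr.
apply: eq_bigr => p _; rewrite scaler_sumr; apply: eq_bigr => q _.
by rewrite scalerA mcoeffZ mulrCA.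
Qed.

Lemma pa_mul0l g : pa_mul 0 g = 0.
Proof. by rewrite /pa_mul msupp0 big_seq_fset0. Qed.

Lemma pa_mul0r f : pa_mul f 0 = 0.
Proof. by rewrite /pa_mul big1 // => p _; rewrite msupp0 big_seq_fset0. Qed.

Lemma pa_mulUU p q : pa_mul (path_elt p) (path_elt q) = path_mul p q.
Proof.
rewrite (pa_mulw (msuppU_le (x := 1)) (msuppU_le (x := 1))) !big_seq_fset1.
by rewrite !mcoeffUU mul1r scale1r.
Qed.

Lemma malgUZ (c : k) p : << c *g p >> = c *: << p >> :> {malg k[qpath Q]}.
Proof. by apply/malgP => q; rewrite mcoeffU mcoeffZ mcoeffU mulrnAr mulr1. Qed.

Lemma path_eltE f : f = \sum_(p <- msupp f) f@_p *: path_elt p.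
Proof. by rewrite {1}[f]monalgE; apply: eq_bigr => p _; apply: malgUZ. Qed.

Lemma path_alg_ind (P : kQ -> Prop) : P 0 ->
  (forall f g, P f -> P g -> P (f + g)) -> (forall c f, P f -> P (c *: f)) ->
  (forall p, P (path_elt p)) -> forall f, P f.
Proof.
move=> P0 PD PZ PU f; rewrite (path_eltE f).
by apply: (big_ind P) => // p _; apply: PZ.
Qed.

Lemma pa_mulUp p q r : pa_mul (path_elt p) (path_mul q r) =
  oapp path_elt 0 (obind (pconcat p) (pconcat q r)).
Proof.
rewrite /path_mul; case: (pconcat q r) => [y|] /=; last exact: pa_mul0r.
exact: pa_mulUU.
Qed.

Lemma pa_mulpU p q r : pa_mul (path_mul p q) (path_elt r) =
  oapp path_elt 0 (obind (fun x => pconcat x r) (pconcat p q)).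
Proof.
rewrite /path_mul; case: (pconcat p q) => [y|] /=; last exact: pa_mul0l.
exact: pa_mulUU.
Qed.

Lemma pa_mulA : associative pa_mul.
Proof.
apply: (bilinear_assoc path_alg_ind pa_mulDl pa_mulDr pa_mulZl pa_mulZr) => p q r.
apply: etrans (congr1 (pa_mul _) (pa_mulUU q r)) _.
apply: etrans (pa_mulUp p q r) _; apply: esym.
apply: etrans (congr1 (pa_mul^~ _) (pa_mulUU p q)) _.
by apply: etrans (pa_mulpU p q r) _; rewrite pconcatA.
Qed.

Lemma pa_lazyl v p : pa_mul (path_elt (lazy_path v)) (path_elt p) =
  if v == (val p).1 then path_elt p else 0.
Proof. by apply: etrans (pa_mulUU _ _) _; rewrite /path_mul pconcat1; case: ifP. Qed.

Lemma pa_lazyr v p : pa_mul (path_elt p) (path_elt (lazy_path v)) =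
  if v == path_end (val p).1 (val p).2 then path_elt p else 0.
Proof.
apply: etrans (pa_mulUU _ _) _.
by rewrite /path_mul pconcat_1 eq_sym; case: ifP.
Qed.

Lemma pa_mul1l : left_id pa_one pa_mul.
Proof.
move=> f; elim/path_alg_ind: f => [|f f' IH IH'|c f IH|p].
- by rewrite pa_mul0r.
- by rewrite pa_mulDr IH IH'.
- by rewrite -pa_mulZr IH.
have -> : pa_mul pa_one (path_elt p)
        = \sum_(v : vertex Q) pa_mul (path_elt (lazy_path v)) (path_elt p).
  exact: (big_morph (pa_mul^~ _) (fun _ _ => pa_mulDl _ _ _) (pa_mul0l _)).
by rewrite (eq_bigr _ (fun v _ => pa_lazyl v p)) -big_mkcond big_pred1_eq.
Qed.

Lemma pa_mul1r : right_id pa_one pa_mul.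
Proof.
move=> f; elim/path_alg_ind: f => [|f f' IH IH'|c f IH|p].
- by rewrite pa_mul0l.
- by rewrite pa_mulDl IH IH'.
- by rewrite -pa_mulZl IH.
have -> : pa_mul (path_elt p) pa_one
        = \sum_(v : vertex Q) pa_mul (path_elt p) (path_elt (lazy_path v)).
  exact: (big_morph (pa_mul _) (fun _ _ => pa_mulDr _ _ _) (pa_mul0r _)).
by rewrite (eq_bigr _ (fun v _ => pa_lazyr v p)) -big_mkcond big_pred1_eq.
Qed.

HB.instance Definition _ := GRing.Zmodule_isPzRing.Build kQ
  pa_mulA pa_mul1l pa_mul1r pa_mulDl pa_mulDr.

Definition pa_scalar (c : k) : kQ := c *: pa_one.

Lemma pa_scalar_zmod : zmod_morphism pa_scalar.
Proof. by move=> a b; rewrite /pa_scalar scalerBl. Qed.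
Lemma pa_scalarl c f : pa_scalar c * f = c *: f.
Proof. exact: etrans (esym (pa_mulZl c pa_one f)) (congr1 _ (pa_mul1l f)). Qed.
Lemma pa_scalarr c f : f * pa_scalar c = c *: f.
Proof. exact: etrans (esym (pa_mulZr c f pa_one)) (congr1 _ (pa_mul1r f)). Qed.
Lemma pa_scalar_monoid : monoid_morphism pa_scalar.
Proof.
split=> [|a b]; first exact: scale1r.
by rewrite pa_scalarl /pa_scalar scalerA.
Qed.

HB.instance Definition _ := GRing.isZmodMorphism.Build k kQ pa_scalar pa_scalar_zmod.
HB.instance Definition _ := GRing.isMonoidMorphism.Build k kQ pa_scalar pa_scalar_monoid.

Lemma pa_scalar_central c f : pa_scalar c * f = f * pa_scalar c.
Proof. by rewrite pa_scalarl pa_scalarr. Qed.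

HB.instance Definition _ := PzRing_isAlgOver.Build k kQ pa_scalar_central.

End PathAlgebra.

Section Ideals.
Variable A : pzRingType.

Definition two_sided_ideal (I : A -> Prop) : Prop :=
  [/\ I 0,
      forall x y, I x -> I y -> I (x - y),
      forall a x, I x -> I (a * x) &
      forall a x, I x -> I (x * a)].

Definition gen_ideal (S : A -> Prop) : A -> Prop := fun x =>
  forall I, two_sided_ideal I -> (forall y, S y -> I y) -> I x.

Definition ideal_mul (I J : A -> Prop) : A -> Prop := fun x =>
  exists n (y z : 'I_n -> A),
    [/\ forall i, I (y i), forall i, J (z i) & x = \sum_(i < n) y i * z i].

Fixpoint ideal_exp (I : A -> Prop) (m : nat) : A -> Prop :=
  if m is m'.+1 then ideal_mul (ideal_exp I m') I else fun _ => True.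

End Ideals.

(* Membership is a boolean predicate only because MathComp's quotients require
   it. *)
Record bideal (R : pzRingType) := BIdeal {
  bideal_pred :> zmodClosed R;
  bidealP : two_sided_ideal (fun x => x \in bideal_pred)
}.

Section QuotientAlgebra.
Variables (k : pzRingType) (R : pzAlgType k) (I : bideal R).

Definition quot_alg : Type := Quotient.quot I.

HB.instance Definition _ := GRing.Zmodule.on quot_alg.

Definition qa_pi (x : R) : quot_alg := \pi_(Quotient.quot I) x.

Definition qa_one : quot_alg := qa_pi 1.
Definition qa_mul (x y : quot_alg) : quot_alg :=
  qa_pi (repr (x : Quotient.quot I) * repr (y : Quotient.quot I)).

Lemma qa_piP x y : reflect (qa_pi x = qa_pi y) (x - y \in bideal_pred I).
Proof.
rewrite Quotient.idealrBE; exact: eqP.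
Qed.

Lemma qa_piK (x : quot_alg) : qa_pi (repr (x : Quotient.quot I)) = x.
Proof. exact: reprK. Qed.

Lemma qa_piD : {morph qa_pi : x y / x + y}.
Proof. by move=> x y; rewrite /qa_pi !piE. Qed.

Lemma qa_piM x y : qa_mul (qa_pi x) (qa_pi y) = qa_pi (x * y).
Proof.
have [_ _ IL IR] := bidealP I.
set x' := repr (qa_pi x : Quotient.quot I).
set y' := repr (qa_pi y : Quotient.quot I).
have hx : x' - x \in bideal_pred I by apply/qa_piP; exact: qa_piK.
have hy : y' - y \in bideal_pred I by apply/qa_piP; exact: qa_piK.
apply/qa_piP; rewrite -/x' -/y'.
rewrite -[x' * y'](addrNK (x' * y)) -addrA -mulrBr -mulrBl.
by apply: rpredD; [apply: IL | apply: IR].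
Qed.

Lemma qa_mulA : associative qa_mul.
Proof. by move=> x y z; rewrite -[x]qa_piK -[y]qa_piK -[z]qa_piK !qa_piM mulrA. Qed.
Lemma qa_mul1l : left_id qa_one qa_mul.
Proof. by move=> x; rewrite -[x]qa_piK qa_piM mul1r. Qed.
Lemma qa_mul1r : right_id qa_one qa_mul.
Proof. by move=> x; rewrite -[x]qa_piK qa_piM mulr1. Qed.
Lemma qa_mulDl : left_distributive qa_mul +%R.
Proof.
move=> x y z; rewrite -[x]qa_piK -[y]qa_piK -[z]qa_piK.
by rewrite -qa_piD !qa_piM mulrDl qa_piD.
Qed.
Lemma qa_mulDr : right_distributive qa_mul +%R.
Proof.
move=> x y z; rewrite -[x]qa_piK -[y]qa_piK -[z]qa_piK.
by rewrite -qa_piD !qa_piM mulrDr qa_piD.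
Qed.

HB.instance Definition _ := GRing.Zmodule_isPzRing.Build quot_alg
  qa_mulA qa_mul1l qa_mul1r qa_mulDl qa_mulDr.

Lemma qa_pi_zmod : zmod_morphism qa_pi.
Proof. by move=> x y; rewrite /qa_pi !piE. Qed.
Lemma qa_pi_monoid : monoid_morphism qa_pi.
Proof. by split=> // x y; rewrite -qa_piM. Qed.

HB.instance Definition _ := GRing.isZmodMorphism.Build R quot_alg qa_pi qa_pi_zmod.
HB.instance Definition _ := GRing.isMonoidMorphism.Build R quot_alg qa_pi qa_pi_monoid.

Definition qa_scalar : {rmorphism k -> quot_alg} := qa_pi \o alg_scalar R.

Lemma qa_scalar_central c (x : quot_alg) : qa_scalar c * x = x * qa_scalar c.
Proof. by rewrite -[x]qa_piK /qa_scalar /= -!rmorphM alg_scalar_central. Qed.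

HB.instance Definition _ := PzRing_isAlgOver.Build k quot_alg qa_scalar_central.

End QuotientAlgebra.

Definition arrow_ideal (k : fieldType) (Q : quiver) : path_alg k Q -> Prop :=
  gen_ideal (fun x => exists a : arrow Q, x = path_elt k (arrow_path a)).

Record admissible_ideal (k : fieldType) (Q : quiver) := AdmissibleIdeal {
  aideal :> bideal (path_alg k Q);
  aideal_admissible :
    (forall x, x \in aideal -> ideal_exp (@arrow_ideal k Q) 2 x) /\
    exists2 m : nat, (2 <= m)%N &
      forall x, ideal_exp (@arrow_ideal k Q) m x -> x \in aideal
}.

Definition bound_quiver_alg (k : fieldType) (Q : quiver)
  (I : admissible_ideal k Q) : pzAlgType k := quot_alg I.

Definition is_bound_quiver_alg (k : fieldType) (A : pzAlgType k) : Prop :=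
  exists (Q : quiver) (I : admissible_ideal k Q)
         (f : {rmorphism bound_quiver_alg I -> A}),
    (forall c : k, f (alg_scalar (bound_quiver_alg I) c) = alg_scalar A c) /\
    bijective f.

(* Restriction of scalars along k -> A. *)
Definition restr_scalars (k : fieldType) (A : pzAlgType k) (M : lmodType A) : Type := M.

Section RestrictScalars.
Variables (k : fieldType) (A : pzAlgType k) (M : lmodType A).
Local Notation Mk := (restr_scalars M).

HB.instance Definition _ := GRing.Zmodule.on Mk.

Definition rs_scale (c : k) (x : Mk) : Mk := alg_scalar A c *: (x : M).

Lemma rs_scaleA a b x : rs_scale a (rs_scale b x) = rs_scale (a * b) x.
Proof. by rewrite /rs_scale scalerA rmorphM. Qed.
Lemma rs_scale1 : left_id 1 rs_scale.
Proof. by move=> x; rewrite /rs_scale rmorph1 scale1r. Qed.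
Lemma rs_scaleDr : right_distributive rs_scale +%R.
Proof. by move=> c x y; rewrite /rs_scale scalerDr. Qed.
Lemma rs_scaleDl x : {morph rs_scale^~ x : a b / a + b}.
Proof. by move=> a b; rewrite /rs_scale rmorphD scalerDl. Qed.

HB.instance Definition _ := GRing.Zmodule_isLmodule.Build k Mk
  rs_scaleA rs_scale1 rs_scaleDr rs_scaleDl.

End RestrictScalars.

Section Dsum.
Variables (A : pzRingType) (n : nat) (M : 'I_n -> lmodType A).

Definition dsum : Type := {dffun forall i : 'I_n, M i}.

HB.instance Definition _ := Choice.on dsum.

Implicit Types x y z : dsum.

Definition dsum_zero : dsum := finfun (fun i => 0 : M i).
Definition dsum_opp x : dsum := finfun (fun i => - x i : M i).
Definition dsum_add x y : dsum := finfun (fun i => x i + y i : M i).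
Definition dsum_scale (a : A) x : dsum := finfun (fun i => a *: x i : M i).

Lemma dsum_addA : associative dsum_add.
Proof. by move=> x y z; apply/ffunP => i; rewrite !ffunE addrA. Qed.
Lemma dsum_addC : commutative dsum_add.
Proof. by move=> x y; apply/ffunP => i; rewrite !ffunE addrC. Qed.
Lemma dsum_add0 : left_id dsum_zero dsum_add.
Proof. by move=> x; apply/ffunP => i; rewrite !ffunE add0r. Qed.
Lemma dsum_addN : left_inverse dsum_zero dsum_opp dsum_add.
Proof. by move=> x; apply/ffunP => i; rewrite !ffunE addNr. Qed.

HB.instance Definition _ := GRing.isZmodule.Build dsum
  dsum_addA dsum_addC dsum_add0 dsum_addN.

Lemma dsum_scaleA a b x : dsum_scale a (dsum_scale b x) = dsum_scale (a * b) x.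
Proof. by apply/ffunP => i; rewrite !ffunE scalerA. Qed.
Lemma dsum_scale1 : left_id 1 dsum_scale.
Proof. by move=> x; apply/ffunP => i; rewrite !ffunE scale1r. Qed.
Lemma dsum_scaleDr : right_distributive dsum_scale +%R.
Proof. by move=> a x y; apply/ffunP => i; rewrite !ffunE scalerDr. Qed.
Lemma dsum_scaleDl x : {morph dsum_scale^~ x : a b / a + b}.
Proof. by move=> a b; apply/ffunP => i; rewrite !ffunE scalerDl. Qed.

HB.instance Definition _ := GRing.Zmodule_isLmodule.Build A dsum
  dsum_scaleA dsum_scale1 dsum_scaleDr dsum_scaleDl.

End Dsum.

Section Modules.
Variables (k : fieldType) (A : pzAlgType k).
Implicit Types M N P X : lmodType A.

Definition finite_dim M : Prop :=
  exists n (f : {linear restr_scalars M -> 'rV[k]_n}), bijective f.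

Definition mod_iso M N : Prop := exists f : {linear M -> N}, bijective f.

Definition zero_mod M : Prop := forall x : M, x = 0.

Definition indecomposable M : Prop :=
  ~ zero_mod M /\
  forall N1 N2 : lmodType A,
    mod_iso M (N1 * N2)%type -> zero_mod N1 \/ zero_mod N2.

Definition is_summand N M : Prop :=
  exists N' : lmodType A, mod_iso M (N * N')%type.

Definition basic M : Prop :=
  forall n (N : 'I_n -> lmodType A),
    (forall i, indecomposable (N i)) -> mod_iso M (dsum N) ->
    forall i j, mod_iso (N i) (N j) -> i = j.

Definition projective (P : lmodType A) : Prop :=
  forall (M N : lmodType A) (g : {linear M -> N}) (f : {linear P -> N}),
    (forall y, exists x, g x = y) ->
    exists h : {linear P -> M}, forall x, g (h x) = f x.

Definition in_add X M : Prop :=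
  finite_dim M /\
  forall N, indecomposable N -> is_summand N M -> is_summand N X.

Record add_cat X := AddObj {
  add_obj :> lmodType A;
  add_objP : in_add X add_obj
}.

Definition indec_proj_enum n (P : 'I_n -> lmodType A) : Prop :=
  [/\ forall i, [/\ finite_dim (P i), projective (P i) & indecomposable (P i)],
      forall i j, mod_iso (P i) (P j) -> i = j &
      forall M, finite_dim M -> projective M -> indecomposable M ->
        exists i, mod_iso M (P i)].

Definition is_gvector n (P : 'I_n -> lmodType A) M (u : 'I_n -> nat) : Prop :=
  mod_iso M (dsum (fun i => dsum (fun _ : 'I_(u i) => P i))).

End Modules.

Section AddObjects.
Variables (k : fieldType) (A : pzAlgType k).
Implicit Types M N X Y : lmodType A.

Lemma mod_isoI M N (f : M -> N) : linear f -> bijective f -> mod_iso M N.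
Proof.
move=> flin fbij; pose fL := GRing.isLinear.Build A M N *:%R f flin.
by pose g : {linear M -> N} := HB.pack f fL; exists g.
Qed.

Lemma is_summandl N X Y : is_summand N X -> is_summand N (X * Y)%type.
Proof.
move=> [N' [f [g fK gK]]]; exists (N' * Y)%type.
apply: (@mod_isoI _ _ (fun z : X * Y => ((f z.1).1, ((f z.1).2, z.2)))).
  by move=> a [x y] [x' y'] /=; rewrite linearP.
exists (fun z : N * (N' * Y) => (g (z.1, z.2.1), z.2.2)).
  by move=> [x y] /=; rewrite -surjective_pairing fK.
by move=> [n [n' y]] /=; rewrite gK.
Qed.

Lemma is_summandr N X Y : is_summand N Y -> is_summand N (X * Y)%type.
Proof.
move=> [N' [f [g fK gK]]]; exists (N' * X)%type.
apply: (@mod_isoI _ _ (fun z : X * Y => ((f z.2).1, ((f z.2).2, z.1)))).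
  by move=> a [x y] [x' y'] /=; rewrite linearP.
exists (fun z : N * (N' * X) => (z.2.2, g (z.1, z.2.1))).
  by move=> [x y] /=; rewrite -surjective_pairing fK.
by move=> [n [n' y]] /=; rewrite gK.
Qed.

Definition add_self X (hX : finite_dim X) : add_cat X :=
  AddObj (conj hX (fun _ _ hN => hN)).

Definition add_inl X Y (M : add_cat X) : add_cat (X * Y)%type :=
  AddObj (conj (add_objP M).1
               (fun N hN hNM => is_summandl Y ((add_objP M).2 N hN hNM))).

Definition add_inr X Y (M : add_cat Y) : add_cat (X * Y)%type :=
  AddObj (conj (add_objP M).1
               (fun N hN hNM => is_summandr X ((add_objP M).2 N hN hNM))).

End AddObjects.

Arguments add_inl {k A X} Y M.
Arguments add_inr {k A} X {Y} M.

(* A functor on full subcategories of module categories, additive on morphisms.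
   Morphisms are identified when they agree pointwise (fmap_ext). *)
Record additive_functor (k l : fieldType) (A : pzAlgType k) (B : pzAlgType l)
    (X : lmodType A) (Y : lmodType B) := AdditiveFunctor {
  fobj :> add_cat X -> add_cat Y;
  fmap : forall M N : add_cat X, {linear M -> N} -> {linear fobj M -> fobj N};
  fmap_ext : forall (M N : add_cat X) (f g : {linear M -> N}),
    f =1 g -> fmap f =1 fmap g;
  fmap_id : forall M : add_cat X, @fmap M M idfun =1 idfun;
  fmap_comp : forall (M N O : add_cat X)
      (g : {linear N -> O}) (f : {linear M -> N}),
    @fmap M O (g \o f) =1 fmap g \o fmap f;
  fmap_add : forall (M N : add_cat X) (f g : {linear M -> N}),
    @fmap M N (f \+ g) =1 fmap f \+ fmap g
}.

Arguments fmap {k l A B X Y} F M N f : rename.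

Section Complexes.
Variables (k : fieldType) (A : pzAlgType k).

Record complex := Complex {
  cterm :> int -> lmodType A;
  cdiff : forall i, {linear cterm i -> cterm (i + 1)};
  cdiffK : forall i (x : cterm i), cdiff (i + 1) (cdiff i x) = 0
}.

Section Shift.
Variable X : complex.

Definition shift_term (i : int) : lmodType A := X (i + 1).
Definition shift_diff (i : int) : {linear shift_term i -> shift_term (i + 1)} :=
  -%R \o cdiff X (i + 1).
Lemma shift_diffK i (x : shift_term i) :
  shift_diff (i + 1) (shift_diff i x) = 0.
Proof. by rewrite /= linearN cdiffK !oppr0. Qed.
Definition shift : complex := Complex shift_diffK.

End Shift.

Record chain_map (X Y : complex) := ChainMap {
  cmap :> forall i, {linear X i -> Y i};
  cmap_diff : forall i (x : X i), cmap (i + 1) (cdiff X i x) = cdiff Y i (cmap i x)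
}.

(* The component h i of the homotopy goes from degree i + 1 to degree i, and the
   condition is stated in degree i + 1; i ranges over all integers, so this
   covers every degree. *)
Definition null_homotopic (X Y : complex) (f : chain_map X Y) : Prop :=
  exists h : forall i, {linear X (i + 1) -> Y i},
    forall i (x : X (i + 1)),
      f (i + 1) x = cdiff Y i (h i x) + h (i + 1) (cdiff X (i + 1) x).

(* Hom(X, Y) = 0 in the homotopy category. *)
Definition hom_K_zero (X Y : complex) : Prop :=
  forall f : chain_map X Y, null_homotopic f.

Definition in_Kb_proj (X : complex) : Prop :=
  [/\ forall i, finite_dim (X i),
      forall i, projective (X i) &
      exists n : nat, forall i : int, (n < `|i|)%N -> zero_mod (X i)].

Definition two_term (X : complex) : Prop :=
  forall i : int, i <> 0 -> i <> -1 -> zero_mod (X i).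

Definition rigid (X : complex) : Prop := hom_K_zero X (shift X).

Definition two_term_presilting (X : complex) : Prop :=
  [/\ in_Kb_proj X, two_term X & rigid X].

Section TwoTerm.
Variables (P Q : lmodType A) (phi : {linear P -> Q}).

(* P in degree -1 (= Negz 0), Q in degree 0. *)
Definition tt_term (i : int) : lmodType A :=
  match i with
  | Posz 0 => Q
  | Negz 0 => P
  | _ => 'rV[A]_0
  end.

Definition tt_diff (i : int) : {linear tt_term i -> tt_term (i + 1)} :=
  match i with
  | Negz 0 => phi
  | _ => \0
  end.

Lemma tt_diffK i (x : tt_term i) : tt_diff (i + 1) (tt_diff i x) = 0.
Proof. by case: i x => [n|[|n]] x //=; rewrite linear0. Qed.

Definition two_term_complex : complex := Complex tt_diffK.

End TwoTerm.
End Complexes.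

(* Main.v *)
Require Import Defs.
From mathcomp Require Import all_boot all_order all_algebra.
From HB Require Import structures.
From Stdlib Require Import Classical.
Import GRing.Theory.
Local Open Scope ring_scope.

(** For a two-term complex [phi : P -> Q], a chain map from the complex to its
    shift is just a linear map [f : P -> Q], and a null homotopy of it is a pair
    of endomorphisms [a] of [Q] and [b] of [P] with [f + phi b = a phi]
    ([rigid_two_termP]).  The latter is an equation between compositions and
    sums, so an additive functor preserves it.  Hence rigidity passes from [phi]
    to [F phi] as soon as every map [F P -> F Q] is the image under [F] of some
    map [P -> Q] ([fmap_rigid]).

    The hypotheses on [F] give this fullness for the pair [(PL, QL)] only.  It
    extends to all [P'] in add [PL] and [Q'] in add [QL] because the identity of
    [P'] is a finite sum of endomorphisms factoring through [PL]: composing a map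
    out of [F P'] with the images of these factorizations reduces it to maps out
    of [F PL], and likewise for targets.  Projectivity of [F P'] and [F Q'] comes
    from the same principle, since maps out of [F PL] can be lifted.

    That principle is [in_add_ind].  It rests on splitting a finite-dimensional
    module into indecomposables ([add_factor_ind]), by induction on the dimension
    of a coordinate space in which the module embeds. *)

(** * Finite-dimensional and projective modules *)

Lemma linear_pack {A : pzRingType} {M N : lmodType A} {f : M -> N} :
  linear f -> exists g : {linear M -> N}, g =1 f.
Proof.
move=> flin; pose fL := GRing.isLinear.Build A M N *:%R f flin.
by pose g : {linear M -> N} := HB.pack f fL; exists g.
Qed.

Lemma linear_inverse {A : pzRingType} {M N : lmodType A} {f : {linear M -> N}} :
  bijective f -> exists2 g : {linear N -> M}, cancel f g & cancel g f.
Proof.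
case=> g fK gK.
have glin : linear g.
  by move=> a x y; apply: (can_inj fK); rewrite linearP !gK.
have [g' g'E] := linear_pack glin.
by exists g' => x; rewrite g'E ?fK ?gK.
Qed.

Section Decomposition.
Context {k : fieldType} {A : pzAlgType k}.
Implicit Types M N X W V : lmodType A.

Lemma mod_iso_prod_biproduct {M N1 N2} : mod_iso M (N1 * N2)%type ->
  exists (i1 : {linear N1 -> M}) (p1 : {linear M -> N1})
         (i2 : {linear N2 -> M}) (p2 : {linear M -> N2}),
    [/\ cancel i1 p1, cancel i2 p2, forall x, p1 (i2 x) = 0,
        forall x, p2 (i1 x) = 0 & forall x, i1 (p1 x) + i2 (p2 x) = x].
Proof.
move=> [f /linear_inverse[g fK gK]].
have [i1 i1E] : exists i : {linear N1 -> M}, i =1 (fun x => g (x, 0)).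
  apply: linear_pack => a x y; rewrite -linearP; congr (g _).
  by rewrite -[RHS]/(_, _) /= scaler0 addr0.
have [i2 i2E] : exists i : {linear N2 -> M}, i =1 (fun x => g (0, x)).
  apply: linear_pack => a x y; rewrite -linearP; congr (g _).
  by rewrite -[RHS]/(_, _) /= scaler0 addr0.
have [p1 p1E] : exists p : {linear M -> N1}, p =1 (fun x => (f x).1).
  by apply: linear_pack => a x y; rewrite linearP.
have [p2 p2E] : exists p : {linear M -> N2}, p =1 (fun x => (f x).2).
  by apply: linear_pack => a x y; rewrite linearP.
exists i1, p1, i2, p2.
split=> x; rewrite ?(i1E, i2E) ?(p1E, p2E) ?gK // -linearD -[RHS]fK.
by congr (g _); rewrite -[LHS]/(_, _) /= addr0 add0r -surjective_pairing.
Qed.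

Lemma summand_retract {N X} : is_summand N X ->
  exists (i : {linear N -> X}) (p : {linear X -> N}), cancel i p.
Proof.
move=> [N' /mod_iso_prod_biproduct[i [p [i' [p' [iK _ _ _ _]]]]]].
by exists i, p.
Qed.

Lemma is_summand_refl M : is_summand M M.
Proof.
exists 'rV[A]_0; apply: (@mod_isoI _ _ _ _ (fun x => (x, 0))).
  by move=> a x y; rewrite -[RHS]/(_, _) /= scaler0 addr0.
by exists fst => // -[x y]; rewrite (thinmx0 y).
Qed.

Lemma is_summand_iso {M M' N} :
  mod_iso M M' -> is_summand N M' -> is_summand N M.
Proof.
move=> [f fb] [N' [g gb]].
by exists N', (g \o f); apply: bij_comp.
Qed.

Lemma decomposable {M} : ~ zero_mod M -> ~ indecomposable M ->
  exists N1 N2 : lmodType A,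
    [/\ mod_iso M (N1 * N2)%type, ~ zero_mod N1 & ~ zero_mod N2].
Proof.
move=> Mn0 Mdec; apply: NNPP => none; apply: Mdec; split=> // N1 N2 iso.
apply: NNPP => /not_or_and[n1 n2].
by apply: none; exists N1, N2.
Qed.

(** An upper bound on the dimension.  Asking for an injection instead of a
    bijection lets the bound pass to a summand by dropping one coordinate,
    without choosing a basis of the summand. *)
Definition embeds_in_dim (n : nat) M : Prop :=
  exists2 f : M -> 'rV[k]_n,
    forall c x y, f (alg_scalar A c *: x + y) = c *: f x + f y & injective f.

(** A vector [v] of [k^n] coming from a nonzero element of [N'] spans a line that
    meets the image of [N] trivially, so projecting [N] along [v] onto a
    coordinate hyperplane where the coordinate of [v] is nonzero stays
    injective. *)
Lemma embeds_complement {n M N N'} {i : {linear N -> M}} {j : {linear N' -> M}} :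
    (forall x y, i x = j y -> x = 0) -> injective j -> ~ zero_mod N' ->
  embeds_in_dim n M -> embeds_in_dim n.-1 N /\ (0 < n)%N.
Proof.
move=> indep jinj /not_all_ex_not[y y0] [f flin finj].
have f0 : f 0 = 0.
  by have := flin (-1) 0 0; rewrite scaler0 addr0 scaleN1r addNr.
have [l vl] : exists l, f (j y) 0 l != 0.
  apply/rV0Pn/eqP => fjy; apply: y0; apply: jinj; apply: finj.
  by rewrite fjy linear0 f0.
split; last by apply: leq_ltn_trans (ltn_ord l).
set v := f (j y) in vl *.
pose proj (w : 'rV[k]_n) := w - (w 0 l / v 0 l) *: v.
have projl w : proj w 0 l = 0 by rewrite !mxE divfK ?subrr.
exists (fun x => col' l (proj (f (i x)))) => [c x x'|x x' /matrixP e].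
  rewrite linearP flin; apply/rowP => m; rewrite !mxE.
  by rewrite !mulrDl mulrBr opprD addrACA !mulrA.
have {}e : proj (f (i x)) = proj (f (i x')).
  apply/rowP => m; case: (unliftP l m) => [m' ->|->]; last by rewrite !projl.
  by have := e 0 m'; rewrite !mxE.
(* The images of x and x' under the projection agree, so f (i x) and f (i x')
   differ by the multiple c of v = f (j y). *)
set c := f (i x) 0 l / v 0 l - f (i x') 0 l / v 0 l.
have /finj e' : f (i x) = f (alg_scalar A c *: j y + i x').
  rewrite flin -/v /c scalerBl addrAC -addrA -[X in _ = _ + X]/(proj _) -e.
  by rewrite /proj addrC subrK.
apply/eqP; rewrite -subr_eq0; apply/eqP.
by apply: (indep _ (alg_scalar A c *: y)); rewrite linearB e' addrK linearZ.
Qed.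

(** Each piece of a full decomposition of [M] is an indecomposable summand of
    [M], hence of [X], and [b \o a] is the sum of its components through these
    summands.  Arbitrary [a] and [b] around [M] are what lets the induction pass
    to the two factors of [M].  The principle replaces an explicit retraction of
    [M] from a power of [X]. *)
Lemma add_factor_ind {X W V} {T : {linear W -> V} -> Prop} :
    (forall f g : {linear W -> V}, f =1 g -> T f -> T g) ->
    T \0 -> (forall f g : {linear W -> V}, T f -> T g -> T (f \+ g)) ->
    (forall (a : {linear W -> X}) (b : {linear X -> V}), T (b \o a)) ->
  forall M, in_add X M ->
    forall (a : {linear W -> M}) (b : {linear M -> V}), T (b \o a).
Proof.
move=> Text T0 TD TX M [[n [f [f' fK _]]] MX].
have Mdim : embeds_in_dim n M.
  exists f; last exact: can_inj fK.
  by move=> c x y; rewrite -(linearP f).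
elim/ltn_ind: n => n IHn in M {f f' fK} MX Mdim *.
move=> a b; have [Mz|Mn0] := classic (zero_mod M).
  by apply: Text T0 => x /=; rewrite (Mz (a x)) linear0.
have [Mi|Mdec] := classic (indecomposable M).
  have [i [p iK]] := summand_retract (MX M Mi (is_summand_refl M)).
  by apply: Text (TX (i \o a) (b \o p)) => x /=; rewrite iK.
have [N1 [N2 [iso n1 n2]]] := decomposable Mn0 Mdec.
have [i1 [p1 [i2 [p2 [i1K i2K p1i2 p2i1 ipD]]]]] := mod_iso_prod_biproduct iso.
have indep1 x y : i1 x = i2 y -> x = 0.
  by move=> e; rewrite -[x]i1K e.
have indep2 x y : i2 x = i1 y -> x = 0.
  by move=> e; rewrite -[x]i2K e.
have [N1dim n_gt0] := embeds_complement indep1 (can_inj i2K) n2 Mdim.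
have [N2dim _] := embeds_complement indep2 (can_inj i1K) n1 Mdim.
have T1 : T ((b \o i1) \o (p1 \o a)).
  apply: IHn N1dim _ _; first by rewrite prednK.
  by move=> N Ni Ns; apply/MX/(is_summand_iso iso)/is_summandl.
have T2 : T ((b \o i2) \o (p2 \o a)).
  apply: IHn N2dim _ _; first by rewrite prednK.
  by move=> N Ni Ns; apply/MX/(is_summand_iso iso)/is_summandr.
by apply: Text (TD _ _ T1 T2) => x /=; rewrite -linearD ipD.
Qed.

(** The same principle for [W = V = M]: an additive property of endomorphisms
    of [M] that holds for those factoring through [X] holds for the identity,
    because the identity is a sum of such endomorphisms. *)
Lemma in_add_ind {X M} {T : {linear M -> M} -> Prop} :
    (forall f g : {linear M -> M}, f =1 g -> T f -> T g) ->
    T \0 -> (forall f g : {linear M -> M}, T f -> T g -> T (f \+ g)) ->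
    (forall (a : {linear M -> X}) (b : {linear X -> M}), T (b \o a)) ->
  in_add X M -> T idfun.
Proof.
move=> Text T0 TD TX MX.
exact: Text (add_factor_ind Text T0 TD TX M MX idfun idfun).
Qed.

End Decomposition.

Lemma projective_iso {k : fieldType} {A : pzAlgType k} {P P' : lmodType A}
    {e : {linear P -> P'}} :
  bijective e -> projective P' -> projective P.
Proof.
move=> /linear_inverse[e' eK _] proj M N g f gsurj.
have [h hE] := proj _ _ g (f \o e') gsurj.
by exists (h \o e) => x; rewrite /= hE /= eK.
Qed.

(** * Additive functors on add categories *)

Section AdditiveFunctors.
Context {k l : fieldType} {A : pzAlgType k} {B : pzAlgType l}.
Context {X : lmodType A} {Y : lmodType B} (F : additive_functor X Y).
Implicit Types M N S : add_cat X.

Lemma fmap0 M N : fmap F M N \0 =1 \0.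
Proof.
move=> x; have := fmap_add (a := F) (M := M) (N := N) \0 \0 x.
rewrite (fmap_ext (g := \0)) => [/= e|y]; last exact: addr0.
by apply: (addrI (fmap F M N \0 x)); rewrite -e addr0.
Qed.

Definition fmap_full M N : Prop :=
  forall g : {linear F M -> F N}, exists f, g =1 fmap F M N f.

(** The property of [h] to be propagated from [S] to [M] is that [g \o F h] lies
    in the image of [F]; it is additive in [h], and for [h = b \o a] through [S]
    it follows from fullness applied to [g \o F b]. *)
Lemma fmap_full_source {S M N} :
  in_add S M -> fmap_full S N -> fmap_full M N.
Proof.
move=> MS full g.
suff [f fE] : exists f, g \o fmap F M M idfun =1 fmap F M N f.
  by exists f => x; rewrite -fE /= fmap_id.
pose T (h : {linear M -> M}) := exists f, g \o fmap F M M h =1 fmap F M N f.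
apply: (@in_add_ind _ _ S M T _ _ _ _ MS).
- move=> h h' hh' [f fE]; exists f => x.
  by rewrite -fE /= (fmap_ext hh').
- by exists \0 => x; rewrite /= !fmap0 linear0.
- move=> h h' [f fE] [f' fE']; exists (f \+ f') => x.
  by rewrite [RHS]fmap_add /= -fE -fE' /= fmap_add linearD.
move=> a b; have [f fE] := full (g \o fmap F S M b).
by exists (f \o a) => x; rewrite [RHS]fmap_comp /= -fE /= fmap_comp.
Qed.

Lemma fmap_full_target {S M N} :
  in_add S N -> fmap_full M S -> fmap_full M N.
Proof.
move=> NS full g.
suff [f fE] : exists f, fmap F N N idfun \o g =1 fmap F M N f.
  by exists f => x; rewrite -fE /= fmap_id.
pose T (h : {linear N -> N}) := exists f, fmap F N N h \o g =1 fmap F M N f.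
apply: (@in_add_ind _ _ S N T _ _ _ _ NS).
- move=> h h' hh' [f fE]; exists f => x.
  by rewrite -fE /= (fmap_ext hh').
- by exists \0 => x; rewrite /= !fmap0.
- move=> h h' [f fE] [f' fE']; exists (f \+ f') => x.
  by rewrite [RHS]fmap_add /= -fE -fE' /= fmap_add.
move=> a b; have [f fE] := full (fmap F N S a \o g).
by exists (b \o f) => x; rewrite [RHS]fmap_comp /= -fE /= fmap_comp.
Qed.

Lemma fmap_projective {S M} :
  in_add S M -> projective (F S) -> projective (F M).
Proof.
move=> MS proj U V g f gsurj.
suff [h hE] : exists h : {linear F M -> U},
    g \o h =1 f \o fmap F M M idfun.
  by exists h => x; rewrite [LHS]hE /= fmap_id.
pose T (e : {linear M -> M}) :=
  exists h : {linear F M -> U}, g \o h =1 f \o fmap F M M e.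
apply: (@in_add_ind _ _ S M T _ _ _ _ MS).
- move=> e e' ee' [h hE]; exists h => x.
  by rewrite hE /= (fmap_ext ee').
- by exists \0 => x; rewrite /= fmap0 !linear0.
- move=> e e' [h hE] [h' hE']; exists (h \+ h') => x.
  by rewrite /= linearD [g (h x)]hE [g (h' x)]hE' /= fmap_add linearD.
move=> a b; have [h hE] := proj _ _ g (f \o fmap F S M b) gsurj.
by exists (h \o fmap F M S a) => x; rewrite /= hE /= fmap_comp.
Qed.

End AdditiveFunctors.

(** * Two-term complexes *)

Section TwoTermComplexes.
Context {k : fieldType} {A : pzAlgType k}.
Context {P Q : lmodType A} (phi : {linear P -> Q}).
Local Notation X := (two_term_complex phi).

(** The shift has the differential [- phi], from degree -2 to degree -1.  A chain
    map to the shift lives in degree -1 only, where a homotopy given by [a] on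
    [Q] and [b] on [P] makes it equal to [- phi b + a phi].  The equation with
    [phi b] on the other side avoids the sign and is ready for an additive
    functor. *)
Lemma rigid_two_termP : rigid X <->
  forall f : {linear P -> Q},
    exists (a : {linear Q -> Q}) (b : {linear P -> P}),
      forall x, f x + phi (b x) = a (phi x).
Proof.
split=> [rig f|rig f].
  pose c (i : int) : {linear X i -> shift X i} :=
    match i with Negz 0 => f | _ => \0 end.
  have cP i (x : X i) : c (i + 1) (cdiff X i x) = cdiff (shift X) i (c i x).
    by case: i x => [n|[|[|n]]] x //=; rewrite ?linear0 ?oppr0.
  have [h hP] := rig (ChainMap cP).
  exists (h (Negz 0)), (h (Negz 1)) => x.
  have := hP (Negz 1) x => /= ->.
  by rewrite addrAC addNr add0r.
have [a [b ab]] := rig (f (Negz 0)).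
pose h (i : int) : {linear X (i + 1) -> shift X i} :=
  match i with Negz 0 => a | Negz 1 => b | _ => \0 end.
have eq0 (u v : 'rV[A]_0) : u = v by rewrite (thinmx0 u) (thinmx0 v).
exists h => i; case: i => [[|n]|[|[|n]]] x.
- exact: eq0.
- exact: eq0.
- exact: eq0.
(* Degree -1 is reached with i = Negz 1 = -2, since homotopies are indexed by
   i and compared in degree i + 1. *)
- have fE (y : P) : f (Negz 0) y = - phi (b y) + a (phi y).
    by rewrite -ab addrC addrK.
  exact: fE.
- by rewrite (thinmx0 x) !linear0 addr0.
Qed.

Lemma two_term_two_term : two_term X.
Proof. by case=> [[|n]|[|n]] //= _ _ x; apply: thinmx0. Qed.

Lemma in_Kb_proj_two_term :
    finite_dim P -> finite_dim Q -> projective P -> projective Q ->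
  in_Kb_proj X.
Proof.
move=> Pfd Qfd Ppr Qpr.
have fd0 : finite_dim ('rV[A]_0 : lmodType A).
  exists 0%N, \0; exists (fun=> 0) => x; [exact: esym (thinmx0 x)|].
  exact: esym (thinmx0 x).
have pr0 : projective ('rV[A]_0 : lmodType A).
  by move=> M N g f _; exists \0 => x; rewrite (thinmx0 x) !linear0.
split.
- by case=> [[|n]|[|n]].
- by case=> [[|n]|[|n]].
exists 1%N; case=> [[|n]|[|n]] //= _ x; exact: thinmx0.
Qed.

End TwoTermComplexes.

Section FunctorsAndComplexes.
Context {k l : fieldType} {A : pzAlgType k} {B : pzAlgType l}.
Context {X : lmodType A} {Y : lmodType B} (F : additive_functor X Y).
Context {P Q : add_cat X} (phi : {linear P -> Q}).

(** Every map [F P -> F Q] is the image of some [f], and the homotopy that [f]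
    has over [A] is carried by [F] to a homotopy of its image. *)
Lemma fmap_rigid : fmap_full F P Q ->
  rigid (two_term_complex phi) -> rigid (two_term_complex (fmap F P Q phi)).
Proof.
move=> full /rigid_two_termP rig; apply/rigid_two_termP => g.
have [f fE] := full g; have [a [b ab]] := rig f.
exists (fmap F _ _ a), (fmap F _ _ b) => x.
rewrite fE -[RHS](fmap_comp a phi) -[X in _ + X](fmap_comp phi b).
by rewrite -[LHS]fmap_add; apply: fmap_ext.
Qed.

End FunctorsAndComplexes.

Theorem lemma3p2
  (kL kG : fieldType) (L : pzAlgType kL) (G : pzAlgType kG)
  (hL : is_bound_quiver_alg L) (hG : is_bound_quiver_alg G)
  (nL nG : nat)
  (IL : 'I_nL -> lmodType L) (IG : 'I_nG -> lmodType G)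
  (hIL : indec_proj_enum IL) (hIG : indec_proj_enum IG)
  (PL QL : lmodType L)
  (PL_fd : finite_dim PL) (PL_proj : projective PL) (PL_basic : basic PL)
  (QL_fd : finite_dim QL) (QL_proj : projective QL) (QL_basic : basic QL)
  (PG QG : lmodType G)
  (PG_fd : finite_dim PG) (PG_proj : projective PG)
  (QG_fd : finite_dim QG) (QG_proj : projective QG)
  (F : additive_functor (PL * QL)%type (PG * QG)%type)
  (eP : {linear F (add_inl QL (add_self PL_fd)) -> PG}) (F1 : bijective eP)
  (eQ : {linear F (add_inr PL (add_self QL_fd)) -> QG}) (F2 : bijective eQ)
  (F3 : forall g : {linear PG -> QG},
          exists f : {linear PL -> QL},
            forall x, g (eP x) =
              eQ (fmap F (add_inl QL (add_self PL_fd))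
                         (add_inr PL (add_self QL_fd)) f x))
  (F4 : forall (X : add_cat (PL * QL)%type)
          (u : 'I_nL -> nat) (v : 'I_nG -> nat),
          is_gvector IL X u -> is_gvector IG (F X) v ->
          (forall (i : 'I_nL) (j : 'I_nG), i = j :> nat -> v j = u i) /\
          (forall j : 'I_nG, (nL <= j)%N -> v j = 0%N))
  (P' : add_cat PL) (Q' : add_cat QL) (phi : {linear P' -> Q'}) :
  two_term_presilting (two_term_complex phi) ->
  two_term_presilting
    (two_term_complex (fmap F (add_inl QL P') (add_inr PL Q') phi)).
Proof.
move=> [_ _ rig].
set SP := add_inl QL (add_self PL_fd) in eP F1 F3.
set SQ := add_inr PL (add_self QL_fd) in eQ F2 F3.
have [eP' ePK _] := linear_inverse F1.
have P'S : in_add SP (add_inl QL P') := add_objP P'.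
have Q'S : in_add SQ (add_inr PL Q') := add_objP Q'.
have full : fmap_full F (add_inl QL P') (add_inr PL Q').
  apply: fmap_full_source P'S _; apply: fmap_full_target Q'S _ => g.
  have [f fE] := F3 (eQ \o g \o eP').
  by exists f => x; apply: (bij_inj F2); rewrite -fE /= ePK.
split; [|exact: two_term_two_term|exact: fmap_rigid full rig].
apply: in_Kb_proj_two_term; try exact: (add_objP _).1.
- exact: fmap_projective P'S (projective_iso F1 PG_proj).
- exact: fmap_projective Q'S (projective_iso F2 QG_proj).
Qed.
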